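(* For each $\lambda<1$ and each $N$, the queue-length process $\mathbf{Q}^{(N)}$ under the SA-JSQ policy (equivalently the empirical tail-measure process $\mathbf{x}^{(N)}$) is positive recurrent.
   Context: Parameters: $M\in\{1,2,\dots\}$; service rates $\mu_1>\dots>\mu_M>0$; proportions $\gamma_j\in(0,1]$ with $\sum_j\gamma_j=1$ and $\sum_j\gamma_j\mu_j=1$; $\lambda>0$; $N$ a positive integer with $N\gamma_j\in\{1,2,\dots\}$ for all $j\in[M]=\{1,\dots,M\}$. System: $N$ servers, $N\gamma_j$ of type $j$ with service rate $\mu_j$, each with its own infinite-buffer FCFS queue; Poisson arrivals of rate $N\lambda$; i.i.d. exponential job sizes of mean $1$. Speed-Aware JSQ (SA-JSQ): each arriving job joins a server with the minimum queue length among all servers; ties between types are broken in favour of the fastest type (smallest $j$), ties within a type uniformly at random. $\mathbf{Q}^{(N)}(t)=(Q^{(N)}_{k,j}(t),k\in[N\gamma_j],j\in[M])\in\mathbb{Z}_+^N$, where $Q^{(N)}_{k,j}(t)$ is the number of jobs (including the one in service) at the $k$-th type $j$ server. It is the Markov chain with rates, from state $\mathbf{Q}$: $\mathbf{Q}\to\mathbf{Q}+\mathbf{e}_{k,j}$ at rate $N\lambda/|I_{\min,j}(\mathbf{Q})|$ if $j=j^\dagger(\mathbf{Q})$ and $k\in I_{\min,j}(\mathbf{Q})$ (rate $0$ otherwise), and $\mathbf{Q}\to\mathbf{Q}-\mathbf{e}_{k,j}$ at rate $\mu_j\mathbf{1}(Q_{k,j}>0)$. Here $I_{\min,j}(\mathbf{Q})$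 is the set of servers of minimum queue length within pool $j$, and $j^\dagger(\mathbf{Q})$ is the smallest index $j$ of a pool containing a server of globally minimum queue length. $\mathbf{x}^{(N)}(t)=(x^{(N)}_{i,j}(t),i\ge1,j\in[M])$ with $x^{(N)}_{i,j}(t)=\frac{1}{N\gamma_j}\sum_{k\in[N\gamma_j]}\mathbf{1}(Q^{(N)}_{k,j}(t)\ge i)$. *)

(* Defs.v *)
From HB Require Import structures.
From mathcomp Require Import all_boot all_order all_algebra.
From mathcomp Require Import all_classical all_reals all_analysis.

Set Implicit Arguments.
Unset Strict Implicit.
Unset Printing Implicit Defensive.

Import Order.TTheory GRing.Theory Num.Theory.
Local Open Scope classical_set_scope.
Local Open Scope ring_scope.

Section ContinuousTimeMarkovChains.
Context {R : realType} {S : countType}.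

(* [r s s'] is the rate of the transition from [s] to [s'], for [s' != s];
   diagonal entries are ignored. *)
Implicit Type r : S -> S -> R.

(* The total rate is meant to be finite and positive at every state: [fine]
   sends an infinite sum to 0, and a chain with an absorbing state is not
   covered, since holding times below are real-valued. *)
Definition exit_rate r (s : S) : R :=
  fine (\esum_(s' in [set s' | s' <> s]) (r s s')%:E).

Definition jump_prob r (s s' : S) : R :=
  if s' == s then 0 else r s s' / exit_rate r s.

Definition jump_time (h : nat -> R) (n : nat) : R := \sum_(i < n) h i.

(* [Y] is the jump chain and [H] the sequence of holding times. Conditionally
   on [Y], the holding times are independent and [H i] is exponential with
   parameter [exit_rate r (Y i)]. *)
Definition jump_chain_holding_times r (d : measure_display)
    (Om : measurableType d) (P : probability Om R)
    (Y : nat -> Om -> S) (H : nat -> Om -> R) : Prop :=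
  [/\ forall n s, measurable [set w | Y n w = s],
      forall n, measurable_fun setT (H n),
      forall n w, 0 < H n w
    & forall (n : nat) (y : nat -> S) (t : nat -> R),
        (forall i, 0 <= t i) ->
        P [set w | forall i, (i <= n)%N -> Y i w = y i /\ t i < H i w] =
        (P [set w | Y 0%N w = y 0%N] *
         ((\prod_(i < n) jump_prob r (y i) (y i.+1)) *
          (\prod_(i < n.+1) expR (- (exit_rate r (y i) * t i))))%:E)%E].

(* The (minimal) continuous-time Markov chain with rates [r] and arbitrary
   initial law; [None] is the cemetery state reached by explosion. *)
Definition markov_chain r (d : measure_display) (Om : measurableType d)
    (P : probability Om R) (X : R -> Om -> option S) : Prop :=
  exists Y : nat -> Om -> S, exists H : nat -> Om -> R,
    jump_chain_holding_times r P Y H /\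
    forall (w : Om) (t : R), 0 <= t ->
      (forall n, jump_time (H ^~ w) n <= t < jump_time (H ^~ w) n.+1 ->
                 X t w = Some (Y n w)) /\
      ((forall n, jump_time (H ^~ w) n <= t) -> X t w = None).

End ContinuousTimeMarkovChains.

(* First time the path [p] is at [z] after having been away from [z]; for a
   right-continuous jump path started at [z] this is the first return time
   inf {t >= first exit time | p t = z}. *)
Definition return_time {R : realType} {T : Type} (p : R -> T) (z : T) :
    \bar R :=
  ereal_inf [set t%:E | t in
    [set t | exists u, [/\ 0 <= u, u < t, p u <> z & p t = z]]].

(* Positive recurrence of the process [f (X t)], for [X] a Markov chain with
   rates [r]: started from any of its states [z], it returns to [z] in finite
   mean time. With [f := id] this is positive recurrence of the chain itself;
   other [f] are meant for functions of the chain that are again Markov. *)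
Definition positive_recurrent {R : realType} {S : countType} {T : Type}
    (r : S -> S -> R) (f : S -> T) : Prop :=
  forall (d : measure_display) (Om : measurableType d) (P : probability Om R)
         (X : R -> Om -> option S) (z : T),
    markov_chain r P X ->
    {ae P, forall w, omap f (X 0 w) = Some z} ->
    (\int[P]_w return_time (fun t => omap f (X t w)) (Some z) < +oo)%E.

Section SpeedAwareJSQ.
(* Pool [j] consists of [m j] servers. Types are numbered from 0, fastest
   first. *)
Context {R : realType} {M : nat} (m : 'I_M -> nat).

Definition server := {j : 'I_M & 'I_(m j)}.

Definition srv (j : 'I_M) (k : 'I_(m j)) : server :=
  Tagged (fun j => 'I_(m j)) k.
Arguments srv : clear implicits.

Definition state := {ffun server -> nat}.

Implicit Types (Q : state) (s : server).

Definition incr Q s : state := [ffun s' => (Q s' + (s' == s))%N].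
Definition decr Q s : state := [ffun s' => (Q s' - (s' == s))%N].

Definition Imin Q (j : 'I_M) : {set 'I_(m j)} :=
  [set k | [forall k', Q (srv j k) <= Q (srv j k')]%N]%SET.

Definition has_global_min Q (j : 'I_M) : bool :=
  [exists k : 'I_(m j), [forall s, Q (srv j k) <= Q s]]%N.

Definition is_jdagger Q (j : 'I_M) : bool :=
  has_global_min Q j && [forall j' : 'I_M, (j' < j)%N ==> ~~ has_global_min Q j'].

(* [a] is the total arrival rate. *)
Definition arrival_rate (a : R) Q s : R :=
  if is_jdagger Q (tag s) && (tagged s \in Imin Q (tag s))
  then a / #|Imin Q (tag s)|%:R else 0.

Definition departure_rate (mu : 'I_M -> R) Q s : R :=
  if (0 < Q s)%N then mu (tag s) else 0.

Definition sajsq_rate (a : R) (mu : 'I_M -> R) Q Q' : R :=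
  \sum_(s : server | Q' == incr Q s) arrival_rate a Q s +
  \sum_(s : server | Q' == decr Q s) departure_rate mu Q s.

(* Entry [i = 0], which is constantly 1, is included. *)
Definition tail_measure Q : nat -> 'I_M -> R :=
  fun i j => (m j)%:R^-1 * \sum_(k < m j) (i <= Q (srv j k))%N%:R.

End SpeedAwareJSQ.

(* Main.v *)
(* Let [Y] be the jump chain. If a function [h >= 0] of the state satisfies
   [c + E_s (h (Y 1)) <= h s] off a state [z], where [c] dominates the mean of
   one plus a holding time, then by induction on the horizon the number of jumps
   plus the time before the first visit of [Y] to [z] has mean at most
   [c + E_s (h (Y 1))] from every [s], so that the return time is integrable.
   The function used is [h Q = sum_s (Q s)^2 + k (1 - rho ^+ d Q)]. Joining a
   shortest queue makes the drift of the quadratic part negative outside a finite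
   set when [lambda < 1]. The bounded part, where [d] counts the steps of a
   possible trajectory to [z], has nonpositive drift off [z], bounded away from
   zero on that finite set when [rho] is small; this takes care of the finite
   set once [k] is large. The tail measure changes at every jump and each of its
   level sets is finite, so the same bound serves both processes. *)

Require Import Defs.
From HB Require Import structures.
From mathcomp Require Import all_boot all_order all_algebra.
From mathcomp Require Import all_classical all_reals all_analysis.
From mathcomp Require Import measurable_realfun.
From mathcomp Require Import lra ring zify.

Import Order.TTheory GRing.Theory Num.Theory.
Local Open Scope classical_set_scope.
Local Open Scope ring_scope.

(** * Sums over countable sets and integrals of nonnegative functions *)

Lemma esum_Zl_le {R : realType} {T : choiceType} (I : set T) (c : R)
    (a : T -> \bar R) :
  0 <= c -> (forall i, 0 <= a i)%E ->
  (\esum_(i in I) (c%:E * a i) <= c%:E * \esum_(i in I) a i)%E.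
Proof.
move=> c0 a0; apply: ge_ereal_sup => _ [X XI <-].
rewrite -ge0_mule_fsumr//; apply: lee_wpmul2l; rewrite ?lee_fin//.
by apply: ereal_sup_ubound; exists X.
Qed.

(** [pickle] embeds [S] in the naturals, so the fibres of [Y] become a disjoint sequence of
    measurable sets; indices outside the range of [pickle] contribute empty sets. *)
Lemma ge0_integral_fibers {R : realType} {d} {Om : measurableType d}
    {S : countType} (mu : {measure set Om -> \bar R}) (D : set Om)
    (Y : Om -> S) (g : Om -> \bar R) :
  measurable D -> (forall s, measurable [set w | Y w = s]) ->
  measurable_fun D g -> (forall w, D w -> 0 <= g w)%E ->
  (\int[mu]_(w in D) g w =
   \esum_(s in setT) \int[mu]_(w in D `&` [set w | Y w = s]) g w)%E.
Proof.
move=> mD mY mg g0.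
pose F k := D `&` [set w | pickle (Y w) = k].
have FE s : F (pickle s) = D `&` [set w | Y w = s].
  apply/seteqP; split => w [Dw /= e]; split => //=; last by rewrite e.
  exact: pcan_inj (@pickleK S) _ _ e.
have F0 k : ~ range (@pickle S) k -> F k = set0.
  by move=> nk; apply/seteqP; split => // w [_ /= e]; apply: nk; exists (Y w).
have mF k : measurable (F k).
  have [[s _ <-]|/F0 ->] := pselect (range (@pickle S) k) => //.
  by rewrite FE; exact: measurableI.
have DE : D = \bigcup_k F k.
  apply/seteqP; split => [w Dw|w [k _ [Dw _]]] //.
  by exists (pickle (Y w)).
rewrite [in LHS]DE ge0_integral_bigcup//; last 3 first.
- by rewrite -DE.
- by move=> w [k _ [Dw _]]; exact: g0.
- apply/trivIsetP => i j _ _ /eqP ij; apply/seteqP.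
  by split => // w [[_ /= e1] [_ /= e2]]; apply: ij; rewrite -e1 -e2.
rewrite nneseries_esumT; last first.
  by move=> k; apply: integral_ge0 => w [Dw _]; exact: g0.
rewrite (_ : \esum_(i in [set: nat]) _ =
   \esum_(i in range (@pickle S)) \int[mu]_(w in F i) g w)%E; last first.
  rewrite [RHS]esum_mkcond; apply: eq_esum => k _.
  case: ifPn => //; rewrite notin_setE => /F0 ->; exact: integral_set0.
rewrite esum_image; last by move=> s t _ _ /(pcan_inj (@pickleK S)).
by apply: eq_esum => s _; rewrite FE.
Qed.

(** Measurability is assumed for [g] alone, so that [f] can be a return time. Raising [g] to [+oo]
    on a measurable null set makes the inequality hold everywhere without changing the integral of
    [g]; every simple function below [f] is then below the new [g]. *)
Lemma ae_ge0_integral_le {R : realType} {d} {Om : measurableType d}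
    (mu : {measure set Om -> \bar R}) (f g : Om -> \bar R) :
  measurable_fun setT g -> (forall w, 0 <= f w)%E -> (forall w, 0 <= g w)%E ->
  {ae mu, forall w, (f w <= g w)%E} ->
  (\int[mu]_w f w <= \int[mu]_w g w)%E.
Proof.
move=> mg f0 g0 [N [mN N0 subN]].
pose g' w : \bar R := if w \in N then +oo%E else g w.
have mg' : measurable_fun setT g'.
  apply: measurable_fun_ifT => //.
  apply: (@measurable_fun_bool _ _ _ _ true).
  rewrite setTI (_ : _ @^-1` _ = N)//.
  by apply/seteqP; split => w /=; [exact: set_mem|exact: mem_set].
have g'0 w : (0 <= g' w)%E by rewrite /g'; case: ifP.
have -> : (\int[mu]_w g w = \int[mu]_w g' w)%E.
  apply: ge0_ae_eq_integral => //; exists N; split => // w /=.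
  move=> h; apply: contrapT => nN; apply: h => _; rewrite /g' ifF//.
  by apply/negbTE; rewrite notin_setE.
rewrite !ge0_integralTE//.
apply: ge_ereal_sup => _ [h hf <-]; apply: ereal_sup_ubound; exists h => // w.
apply: (le_trans (hf w)); rewrite /g'; case: ifPn => [|/negP nN]; first by rewrite leey.
by apply: contrapT => fg; apply: nN; rewrite in_setE; apply: subN.
Qed.

(** * Laws of the jump chain and of the holding times along cylinders *)

Section Foster.
Context {R : realType} {S : countType} (r : S -> S -> R).
Context {d} {Om : measurableType d} (P : probability Om R).
Context (Y : nat -> Om -> S) (H : nat -> Om -> R).
Hypothesis YH : jump_chain_holding_times r P Y H.

Let mY n s : measurable [set w | Y n w = s].
Proof. by case: YH => + _ _ _; apply. Qed.

Let mH n : measurable_fun setT (H n).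
Proof. by case: YH => _ + _ _; apply. Qed.

Let H_gt0 n w : 0 < H n w.
Proof. by case: YH => _ _ + _; apply. Qed.

Let mH_gt n (t : R) : measurable [set w | t < H n w].
Proof.
rewrite (_ : [set w | _] = setT `&` H n @^-1` `]t, +oo[%classic); first exact: mH.
by rewrite setTI; apply/seteqP; split => w /=; rewrite in_itv/= andbT.
Qed.

Definition cylinder n (y : nat -> S) : set Om :=
  [set w | forall i, (i <= n)%N -> Y i w = y i].

Let extend n (y : nat -> S) s i := if (i <= n)%N then y i else s.

Let cylinder_extend n y s :
  cylinder n.+1 (extend n y s) = cylinder n y `&` [set w | Y n.+1 w = s].
Proof.
apply/seteqP; split => w /=.
  move=> h; split => [i le_in|]; first by rewrite h /extend ?le_in// ltnW.
  by rewrite h// /extend ltnn.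
move=> [h1 h2] i; rewrite /extend leq_eqVlt => /predU1P[->|].
  by rewrite ltnn.
by rewrite ltnS => le_in; rewrite le_in h1.
Qed.

Lemma cylinder0 y : cylinder 0 y = [set w | Y 0%N w = y 0%N].
Proof.
by apply/seteqP; split => w /=; [apply|move=> h [|]].
Qed.

Lemma measurable_cylinder n y : measurable (cylinder n y).
Proof.
elim: n y => [|n IHn] y; first by rewrite cylinder0.
rewrite (_ : cylinder n.+1 y = cylinder n y `&` [set w | Y n.+1 w = y n.+1]).
  exact: measurableI.
rewrite -cylinder_extend; apply/seteqP; split => w /= h i le_in; rewrite h//;
  rewrite /extend; case: ifPn => //; rewrite -ltnNge => lt_ni;
  by rewrite (@anti_leq i n.+1)// le_in.
Qed.

(** Holding times are positive, so a threshold 0 is no constraint: the joint law is used with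
    threshold [t] at index [n] and 0 before it. *)
Lemma prob_cylinder_holding n y t : 0 <= t ->
  P (cylinder n y `&` [set w | t < H n w]) =
  (P (cylinder n y) * (expR (- (exit_rate r (y n) * t)))%:E)%E.
Proof.
move=> t0; case: YH => _ _ _ law.
pose u i := if i == n then t else 0.
have u0 i : 0 <= u i by rewrite /u; case: ifP.
have := law n y u u0; have := law n y (fun=> 0) (fun=> lexx 0).
rewrite [X in P X](_ : _ = cylinder n y); last first.
  by apply/seteqP; split => w /= h i le_in; [case: (h i le_in)|split => //; exact: h].
move=> ->.
rewrite [X in P X](_ : _ = cylinder n y `&` [set w | t < H n w]); last first.
  apply/seteqP; split => w /=.
    move=> h; split => [i /h[]//|]; have [_] := h n (leqnn n).
    by rewrite /u eqxx.
  move=> [h1 h2] i le_in; split; first exact: h1.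
  by rewrite /u; case: eqP => [->|].
move=> ->; rewrite -muleA; congr (_ * _)%E; rewrite -EFinM -mulrA; congr (_ * _)%:E.
rewrite big_ord_recr/= [in RHS]big1 => [|i _]; last by rewrite mulr0 oppr0 expR0.
rewrite {2}/u eqxx big1 ?mul1r// => i _.
by rewrite /u ltn_eqF// mulr0 oppr0 expR0.
Qed.

Lemma prob_cylinder_jump n y s :
  P (cylinder n y `&` [set w | Y n.+1 w = s]) =
  (P (cylinder n y) * (jump_prob r (y n) s)%:E)%E.
Proof.
case: YH => _ _ _ law.
have PE k z : P (cylinder k z) =
    (P [set w | Y 0%N w = z 0%N] * (\prod_(i < k) jump_prob r (z i) (z i.+1))%:E)%E.
  have := law k z (fun=> 0) (fun=> lexx 0).
  rewrite [X in P X](_ : _ = cylinder k z); last first.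
    by apply/seteqP; split => w /= h i le_in; [case: (h i le_in)|split => //; exact: h].
  by move=> ->; rewrite [X in _ * X]big1 ?mulr1// => i _; rewrite mulr0 oppr0 expR0.
rewrite -cylinder_extend !PE -muleA -EFinM big_ord_recr/= /extend/= ltnn leqnn.
congr (_ * (_ * _)%:E)%E; apply: eq_bigr => i _ /=.
by rewrite ltn_ord ltnW.
Qed.

(** The second summand is the geometric series of ratio [expR (- a)]. It replaces the exact mean
    [a^-1] of an exponential variable, which avoids integrating a density. *)
Definition holding_bound (a : R) : R := 2 + (1 - expR (- a))^-1.

(** A holding time is at most one plus the number of integers [k] below it, and on the cylinder the
    event [k < H n] has conditional probability at most [expR (- a) ^+ k]. *)
Lemma integral_holding_le n y a : 0 < a -> a <= exit_rate r (y n) ->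
  (\int[P]_(w in cylinder n y) (1 + H n w)%:E
   <= P (cylinder n y) * (holding_bound a)%:E)%E.
Proof.
move=> a0 aq; set A := cylinder n y; set x := expR (- a).
have mA : measurable A by exact: measurable_cylinder.
have x0 : 0 <= x by exact: expR_ge0.
have x1 : 0 < 1 - x by rewrite subr_gt0 -expR0 ltr_expR oppr_lt0.
pose I k : Om -> \bar R := EFin \o \1_[set w | k%:R < H n w].
have mI k : measurable_fun A (I k).
  by apply: measurable_funTS; apply/measurable_EFinP; exact: measurable_indic.
have I0 k w : (0 <= I k w)%E by rewrite /I/= lee_fin indicE ler0n.
(* Only the [k] below the integer part of [H n w] are counted; they may miss [H n w] by up to one,
   hence the constant 2. *)
have ptw w : A w -> ((1 + H n w)%:E <= 2%:E + \sum_(k <oo) I k w)%E.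
  move=> _; have /andP[_ Ht] := truncn_itv (ltW (H_gt0 n w)).
  apply: (@le_trans _ _ (2%:E + \sum_(0 <= k < Num.truncn (H n w)) I k w)%E).
    rewrite (eq_big_nat _ _ (F2 := fun=> 1%:E)); last first.
      move=> k /andP[_ kt]; rewrite /I/= indicE mem_set//=.
      by rewrite (lt_le_trans _ (_ : k.+1%:R <= _))// ?ltr_nat// -truncn_ge_nat// ltW.
    rewrite sumEFin big_const_nat iter_addr_0 subn0 -EFinD lee_fin.
    move: Ht; rewrite -natr1 => Ht; lra.
  by rewrite leeD2l// nneseries_lim_ge.
apply: (@le_trans _ _ (\int[P]_(w in A) (2%:E + \sum_(k <oo) I k w)%E)%E).
  apply: ge0_le_integral => //.
  - by move=> w _; rewrite lee_fin addr_ge0// ltW.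
  - apply: measurable_funTS; apply/measurable_EFinP; exact: measurable_funD.
  - apply: emeasurable_funD => //; exact: ge0_emeasurable_sum.
rewrite ge0_integralD//; last 2 first.
- by move=> w _; exact: nneseries_ge0.
- exact: ge0_emeasurable_sum.
rewrite integral_cst//.
rewrite integral_nneseries//.
rewrite (EFinD 2 (1 - x)^-1) ge0_muleDr ?lee_fin ?invr_ge0 ?(ltW x1)//.
rewrite muleC; apply: leeD2l.
apply: lime_le.
  by apply: is_cvg_nneseries => k _ _; exact: integral_ge0.
apply: nearW => m.
apply: (@le_trans _ _ (\sum_(0 <= k < m) P A * (x ^+ k)%:E)%E).
  apply: lee_sum => k _; rewrite integral_indic// setIC.
  apply: le_trans (_ : (P A * (expR (- (exit_rate r (y n) * k%:R)))%:E <= _)%E).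
    by rewrite -prob_cylinder_holding.
  apply: lee_wpmul2l => //.
  rewrite lee_fin -expRM_natl ler_expR mulrN lerN2 mulrC.
  exact: ler_wpM2r.
rewrite -ge0_sume_distrr; last by move=> k _; rewrite lee_fin exprn_ge0.
apply: lee_wpmul2l => //; rewrite sumEFin lee_fin big_mkord.
rewrite -(ler_pM2l x1) divff ?gt_eqF// -opprB mulNr -subrX1 opprB.
by rewrite lerBlDr lerDl exprn_ge0.
Qed.

(** * The drift criterion and the cost of an excursion from [z] *)

Context (h : S -> R) (z : S) (a : R).
Hypothesis r_ge0 : forall s s', 0 <= r s s'.
Hypothesis a_gt0 : 0 < a.
Hypothesis exit_rate_ge : forall s, a <= exit_rate r s.
Hypothesis h_ge0 : forall s, 0 <= h s.

Let jump_ge0 s s' : 0 <= jump_prob r s s'.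
Proof.
rewrite /jump_prob; case: ifP => // _.
by rewrite divr_ge0// (le_trans (ltW a_gt0)).
Qed.

Definition one_step (s : S) : \bar R :=
  ((holding_bound a)%:E + \esum_(s' in setT) (jump_prob r s s' * h s')%:E)%E.

Hypothesis drift : forall s, s != z -> (one_step s <= (h s)%:E)%E.

Let holding_bound_ge0 : 0 <= holding_bound a.
Proof.
by rewrite /holding_bound addr_ge0// invr_ge0 subr_ge0 -expR0 ler_expR oppr_le0 ltW.
Qed.

Let one_step_ge0 s : (0 <= one_step s)%E.
Proof.
rewrite adde_ge0 ?lee_fin// esum_ge0// => s' _.
by rewrite lee_fin mulr_ge0.
Qed.

(* Counting the jumps as well makes this tend to [+oo] with [k] on the paths that
   never return to [z], so that no separate proof of recurrence is needed. *)
Fixpoint excursion_cost k n w : \bar R :=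
  if k is k'.+1 then
    ((1 + H n w)%:E + (if Y n.+1 w == z then 0 else excursion_cost k' n.+1 w))%E
  else 0%E.

Lemma excursion_cost_ge0 k n w : (0 <= excursion_cost k n w)%E.
Proof.
elim: k n => [|k IHk] n //=; rewrite adde_ge0//; last by case: ifP.
by rewrite lee_fin addr_ge0// ltW.
Qed.

Lemma excursion_cost_leS k n w :
  (excursion_cost k n w <= excursion_cost k.+1 n w)%E.
Proof.
elim: k n => [|k IHk] n; first exact: excursion_cost_ge0.
rewrite [leLHS]/= [leRHS]/=; apply: leeD2l; case: ifP => // _; exact: IHk.
Qed.

Lemma measurable_excursion_cost k n : measurable_fun setT (excursion_cost k n).
Proof.
elim: k n => [|k IHk] n /=; first exact: measurable_cst.
apply: emeasurable_funD.
  by apply/measurable_EFinP; exact: measurable_funD.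
apply: measurable_fun_ifT => //.
apply: (@measurable_fun_bool _ _ _ _ true).
rewrite setTI (_ : _ @^-1` _ = [set w | Y n.+1 w = z])//.
by apply/seteqP; split => w /= /eqP.
Qed.

(** Induction on the horizon [k], splitting on the value of [Y n.+1]: the fibre over [z] has no
    further cost, and on any other fibre the induction hypothesis followed by [drift] gives [h]. The
    bound is by [one_step (y n)] rather than by [h (y n)] so that it also holds when the excursion
    starts at [z]. *)
Lemma integral_excursion_cost_le k n y :
  (\int[P]_(w in cylinder n y) excursion_cost k n w
   <= P (cylinder n y) * one_step (y n))%E.
Proof.
elim: k n y => [|k IHk] n y /=.
  by rewrite integral0 mule_ge0.
have mA : measurable (cylinder n y) by exact: measurable_cylinder.
have mR : measurable_fun (cylinder n y)
    (fun w => if Y n.+1 w == z then 0%E else excursion_cost k n.+1 w).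
  apply: measurable_funTS; apply: measurable_fun_ifT => //.
    apply: (@measurable_fun_bool _ _ _ _ true).
    rewrite setTI (_ : _ @^-1` _ = [set w | Y n.+1 w = z])//.
    by apply/seteqP; split => w /= /eqP.
  exact: measurable_excursion_cost.
have R0 w : (0 <= if Y n.+1 w == z then 0%E else excursion_cost k n.+1 w)%E.
  by case: ifP => // _; exact: excursion_cost_ge0.
rewrite ge0_integralD//; last 2 first.
- by move=> w _; rewrite lee_fin addr_ge0// ltW.
- by apply: measurable_funTS; apply/measurable_EFinP; exact: measurable_funD.
rewrite /one_step ge0_muleDr ?lee_fin//; last first.
  by apply: esum_ge0 => s' _; rewrite lee_fin mulr_ge0.
apply: leeD; first exact: integral_holding_le.
rewrite (ge0_integral_fibers _ _ (Y n.+1))//.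
have Pfin : P (cylinder n y) \is a fin_num by exact: fin_num_measure.
rewrite -(fineK Pfin).
apply: le_trans (esum_Zl_le _ _ _ _ _); last 2 first.
- exact: fine_ge0.
- by move=> s'; rewrite lee_fin mulr_ge0.
apply: le_esum => s _; rewrite (fineK Pfin).
have [->|sz] := eqVneq s z.
  rewrite integral0_eq; last by move=> w [_ /= ->]; rewrite eqxx.
  by rewrite mule_ge0// lee_fin mulr_ge0.
rewrite (eq_integral (excursion_cost k n.+1)); last first.
  by move=> w /[!inE] -[_ /= ->]; rewrite (negbTE sz).
rewrite -cylinder_extend; apply: (le_trans (IHk _ _)).
rewrite cylinder_extend prob_cylinder_jump EFinM muleA.
rewrite /extend ltnn; apply: lee_wpmul2l; last exact: drift.
by rewrite mule_ge0// lee_fin.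
Qed.

Let excursion_cost_before k n w :
  (forall i, (n < i < n + k)%N -> Y i w <> z) ->
  excursion_cost k n w = (\sum_(n <= i < n + k) (1 + H i w))%:E.
Proof.
elim: k n => [|k IHk] n nz /=; first by rewrite addn0 big_geq.
rewrite big_ltn; last by rewrite addnS ltnS leq_addr.
rewrite [RHS]EFinD; congr adde.
(* With a single jump left nothing is known of [Y n.+1], but both branches of the cost are then
   zero. *)
case: k IHk nz => [IHk nz|k IHk nz].
  by rewrite addn1 big_geq//; case: ifP.
rewrite ifF; last by apply/eqP/nz; rewrite ltnSn addnS ltnS addnS ltnS leq_addr.
rewrite IHk ?addSnnS// => i /andP[ni ik]; apply: nz.
by rewrite (ltnW ni).
Qed.

Let excursion_cost_jump_time k w :
  (forall i, (0 < i < k)%N -> Y i w <> z) ->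
  excursion_cost k 0 w = (k%:R + jump_time (H ^~ w) k)%:E.
Proof.
move=> nz; rewrite excursion_cost_before ?add0n// big_split/=.
rewrite big_const_nat iter_addr_0 subn0; congr (_ + _)%:E.
by rewrite /jump_time big_mkord.
Qed.

Let total_cost w : \bar R := limn (fun k => excursion_cost k 0 w).

Let total_cost_cvg w : excursion_cost k 0 w @[k --> \oo] --> total_cost w.
Proof.
apply: ereal_nondecreasing_is_cvgn; apply/nondecreasing_seqP => k.
exact: excursion_cost_leS.
Qed.

Let excursion_cost_le_total k w : (excursion_cost k 0 w <= total_cost w)%E.
Proof.
rewrite /total_cost.
have nd : nondecreasing_seq (fun k => excursion_cost k 0 w).
  by apply/nondecreasing_seqP => j; exact: excursion_cost_leS.
rewrite (cvg_lim _ (ereal_nondecreasing_cvgn nd))//.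
by apply: ereal_sup_ubound; exists k.
Qed.

(** * From the total cost to the return time of a function of the chain *)

Section ReturnTime.
Context {T : Type} (f : S -> T) (X : R -> Om -> option S).
Hypothesis XYH : forall (w : Om) (t : R), 0 <= t ->
  (forall n, jump_time (H ^~ w) n <= t < jump_time (H ^~ w) n.+1 ->
             X t w = Some (Y n w)) /\
  ((forall n, jump_time (H ^~ w) n <= t) -> X t w = None).

Let jump_timeS n w : jump_time (H ^~ w) n.+1 = jump_time (H ^~ w) n + H n w.
Proof. by rewrite /jump_time big_ord_recr. Qed.

Let jump_time_ge0 n w : 0 <= jump_time (H ^~ w) n.
Proof. by apply: sumr_ge0 => i _; exact: ltW. Qed.

Let X_jump_time n w : X (jump_time (H ^~ w) n) w = Some (Y n w).
Proof.
have [Xn _] := XYH w _ (jump_time_ge0 n w); apply: Xn.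
by rewrite lexx jump_timeS ltrDl H_gt0.
Qed.

Let X0 w : X 0 w = Some (Y 0%N w).
Proof. by rewrite -X_jump_time /jump_time big_ord0. Qed.

Let jump_time_mono n m w : (n < m)%N ->
  jump_time (H ^~ w) n < jump_time (H ^~ w) m.
Proof.
elim: m => // m IHm; rewrite ltnS leq_eqVlt => /predU1P[->|/IHm].
  by rewrite jump_timeS ltrDl.
by move=> /lt_trans; apply; rewrite jump_timeS ltrDl.
Qed.

(** As [f (Y 1 w)] differs from [f z], the first jump time witnesses an absence. If [Y] later visits
    [z], the time of that visit bounds the return time and is part of the cost; otherwise the number
    of jumps alone makes the total cost infinite, whether or not the path explodes. *)
Let return_time_le_total w : f (Y 1 w) <> f z ->
  (return_time (fun t => omap f (X t w)) (Some (f z)) <= total_cost w)%E.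
Proof.
move=> Y1z.
have [[n Pn]|noreturn] := pselect (exists n, (0 < n)%N && (Y n w == z)).
  have ex : exists n, (0 < n)%N && (Y n w == z) by exists n.
  have [m /andP[m0 /eqP Ym] m_min] := ex_minnP ex.
  have m1 : (1 < m)%N.
    by case: m m0 Ym {m_min} => [//|[|//]] _ Ym; case: Y1z; rewrite Ym.
  apply: le_trans (excursion_cost_le_total m w).
  rewrite excursion_cost_jump_time; last first.
    move=> i /andP[i0 im] /eqP Yi; have := m_min i; rewrite i0 Yi => /(_ isT).
    by rewrite leqNgt im.
  apply: (@le_trans _ _ (jump_time (H ^~ w) m)%:E); last by rewrite lee_fin lerDr.
  apply: ereal_inf_lbound; exists (jump_time (H ^~ w) m) => //=.
  exists (jump_time (H ^~ w) 1); split => //; first exact: jump_time_mono.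
    by rewrite X_jump_time/= => -[].
  by rewrite X_jump_time/= Ym.
suff -> : total_cost w = +oo%E by rewrite leey.
apply: eq_infty => t.
have [k tk] : exists k : nat, t <= k%:R.
  exists (Num.truncn `|t|).+1; apply: (le_trans (ler_norm t)).
  by have /andP[_ /ltW] := truncn_itv (normr_ge0 t).
apply: le_trans (excursion_cost_le_total k w).
rewrite excursion_cost_jump_time ?lee_fin ?(le_trans tk) ?lerDl//.
by move=> i /andP[i0 _] Yi; apply: noreturn; exists i; rewrite i0 Yi eqxx.
Qed.

(** The chain may start anywhere in the level set of [z], hence a bound [B] uniform over that set.
    The absence of jumps inside the level set makes the first jump leave it almost surely, as the
    pathwise bound requires. *)
Lemma integral_return_time_lty (B : R) :
  (forall s s', f s = f z -> f s' = f z -> jump_prob r s s' = 0) ->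
  (forall s, f s = f z -> (one_step s <= B%:E)%E) ->
  {ae P, forall w, omap f (X 0 w) = Some (f z)} ->
  (\int[P]_w return_time (fun t => omap f (X t w)) (Some (f z)) < +oo)%E.
Proof.
move=> no_jump one_step_le start.
have start0 s : f s <> f z -> P [set w | Y 0%N w = s] = 0%E.
  move=> fs; case: start => N [mN N0 subN].
  apply: (@subset_measure0 _ _ _ _ _ N) => //.
  by move=> w /= Yw; apply: subN => /=; rewrite X0 Yw /= => -[].
have leave : {ae P, forall w, f (Y 1 w) <> f z}.
  (* The exceptional event is covered by the null ones among the countably many events fixing [Y 0]
     and [Y 1], enumerated through [pickle]. *)
  pose F k := if @unpickle (S * S)%type k is Some p then
    if `[< P ([set w | Y 0%N w = p.1] `&` [set w | Y 1%N w = p.2]) = 0%E >]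
    then [set w | Y 0%N w = p.1] `&` [set w | Y 1%N w = p.2] else set0 else set0.
  have F_null k : P.-negligible (F k).
    rewrite /F; case: unpickle => [p|]; last exact: negligible_set0.
    case: asboolP => [p0|_]; last exact: negligible_set0.
    by apply/negligibleP => //; exact: measurableI.
  apply: negligibleS (negligible_bigcup F_null) => w /= /contrapT Y1.
  exists (pickle (Y 0%N w, Y 1%N w)) => //; rewrite /F pickleK /=.
  case: asboolP => // -[].
  have [Y0|Y0] := pselect (f (Y 0%N w) = f z); last first.
    apply: (@subset_measure0 _ _ _ _ _ [set v | Y 0%N v = Y 0%N w]) => //.
    - exact: measurableI.
    - exact: start0.
  rewrite -(cylinder0 (fun=> Y 0%N w)) prob_cylinder_jump.
  by rewrite no_jump// mule0.
apply: (@le_lt_trans _ _ (\int[P]_w total_cost w)%E).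
  apply: ae_ge0_integral_le.
  - apply: (emeasurable_fun_cvg (fun k => excursion_cost k 0)) => [k|w _].
      exact: measurable_excursion_cost.
    exact: total_cost_cvg.
  - move=> w; apply: le_ereal_inf_tmp => _ [t [u [u0 ut _ _]] <-].
    by rewrite lee_fin (le_trans u0)// ltW.
  - by move=> w; apply: le_trans (excursion_cost_le_total 0 w).
  - by apply: filterS leave => w; exact: return_time_le_total.
rewrite (_ : (\int[P]_w total_cost w)%E =
             limn (fun k => \int[P]_w excursion_cost k 0 w)%E); last first.
  apply: monotone_convergence => //.
  - by move=> k; exact: measurable_excursion_cost.
  - by move=> k w _; exact: excursion_cost_ge0.
  - by move=> w _; apply/nondecreasing_seqP => k; exact: excursion_cost_leS.
apply: (@le_lt_trans _ _ `|B|%:E); last by rewrite ltry.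
apply: lime_le.
  apply: ereal_nondecreasing_is_cvgn; apply/nondecreasing_seqP => k.
  apply: ge0_le_integral => //.
  - by move=> w _; exact: excursion_cost_ge0.
  - exact: measurable_excursion_cost.
  - exact: measurable_excursion_cost.
  - by move=> w _; exact: excursion_cost_leS.
apply: nearW => k.
(* Written as an integral, the constant splits over the initial state just as the cost does, and the
   two are compared state by state. *)
have -> : `|B|%:E = (\int[P]_w `|B|%:E)%E.
  rewrite integral_cst//= [X in (_ * X)%E](_ : _ = 1%E) ?mule1//.
  exact: probability_setT.
rewrite (ge0_integral_fibers _ _ (Y 0%N))//; last 2 first.
- exact: measurable_excursion_cost.
- by move=> w _; exact: excursion_cost_ge0.
rewrite [leRHS](ge0_integral_fibers _ _ (Y 0%N))//.
apply: le_esum => s _; rewrite setTI integral_cst//.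
rewrite -(cylinder0 (fun=> s)).
apply: (le_trans (integral_excursion_cost_le k 0 (fun=> s))).
have [fs|fs] := pselect (f s = f z); last first.
  by rewrite cylinder0 start0// mul0e mule_ge0// lee_fin.
rewrite muleC; apply: lee_wpmul2r => //.
by apply: (le_trans (one_step_le _ fs)); rewrite lee_fin ler_norm.
Qed.

End ReturnTime.
End Foster.

(** Distinct moves may share a target, where their rates add; exchanging the two sums lets each move
    count once at its own target. *)
Lemma esum_moves {R : realType} {I : finType} {T : choiceType} (move : I -> T)
    (rate : I -> R) (g : T -> R) :
  (forall i, 0 <= rate i) -> (forall t, 0 <= g t) ->
  (\esum_(t in setT) ((\sum_(i | t == move i) rate i) * g t)%:E =
   (\sum_i rate i * g (move i))%:E)%E.
Proof.
move=> r0 g0; rewrite -sumEFin.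
transitivity (\esum_(t in [set: T])
    \sum_i (if t \in [set move i] then (rate i * g (move i))%:E else 0))%E.
  apply: eq_esum => t _; rewrite mulr_suml -sumEFin big_mkcond/=.
  by apply: eq_bigr => i _; rewrite (_ : (t \in [set move i]) = (t == move i));
    [case: eqP => // ->|apply/idP/eqP => [/set_mem|/mem_set]].
rewrite esum_sum; last by move=> t i _ _; case: ifP => // _; rewrite lee_fin mulr_ge0.
apply: eq_bigr => i _; rewrite -esum_mkcond esum_set1//.
by rewrite lee_fin mulr_ge0.
Qed.

(** * Transition rates and generator of the SA-JSQ chain *)

Section Dynamics.
Context {R : realType} {M : nat} (m : 'I_M -> nat).
Context (a : R) (mu : 'I_M -> R).
Hypothesis a_gt0 : 0 < a.
Hypothesis mu_gt0 : forall j, 0 < mu j.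

Implicit Types (Q : state m) (s : server m).

Local Notation rate := (@sajsq_rate R M m a mu).

Definition total_departure_rate Q : R := \sum_s departure_rate mu Q s.

Definition drift (g : state m -> R) Q : R :=
  \sum_s arrival_rate a Q s * (g (incr Q s) - g Q) +
  \sum_s departure_rate mu Q s * (g (decr Q s) - g Q).

Lemma arrival_rate_ge0 Q s : 0 <= arrival_rate a Q s.
Proof. by rewrite /arrival_rate; case: ifP => // _; rewrite divr_ge0// ltW. Qed.

Lemma departure_rate_ge0 Q s : 0 <= departure_rate mu Q s.
Proof. by rewrite /departure_rate; case: ifP => // _; rewrite ltW. Qed.

Lemma sajsq_rate_ge0 Q Q' : 0 <= rate Q Q'.
Proof.
by rewrite addr_ge0// sumr_ge0// => s _;
  [exact: arrival_rate_ge0|exact: departure_rate_ge0].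
Qed.

Lemma incr_neq Q s : incr Q s <> Q.
Proof.
move=> /(congr1 (fun Q : state m => Q s)); rewrite ffunE eqxx addn1.
by move/eqP; rewrite eqn_leq ltnn.
Qed.

Lemma decrK Q s : (0 < Q s)%N -> incr (decr Q s) s = Q.
Proof.
move=> Qs; apply/ffunP => s'; rewrite !ffunE.
by case: eqP => [->|_]; rewrite ?subnK ?subn0 ?addn0.
Qed.

Lemma decr_neq Q s : (0 < Q s)%N -> decr Q s <> Q.
Proof. by move=> Qs e; apply: (@incr_neq (decr Q s) s); rewrite decrK. Qed.

Lemma esum_sajsq_rate Q (g : state m -> R) : (forall Q', 0 <= g Q') ->
  (\esum_(Q' in setT) (rate Q Q' * g Q')%:E =
   (\sum_s arrival_rate a Q s * g (incr Q s) +
    \sum_s departure_rate mu Q s * g (decr Q s))%:E)%E.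
Proof.
move=> g0.
rewrite EFinD -!esum_moves//; last 2 first.
- exact: departure_rate_ge0.
- exact: arrival_rate_ge0.
rewrite -esumD.
- by apply: eq_esum => Q' _; rewrite -EFinD -mulrDl.
- move=> Q' _; rewrite lee_fin mulr_ge0// sumr_ge0// => s _.
  exact: arrival_rate_ge0.
- move=> Q' _; rewrite lee_fin mulr_ge0// sumr_ge0// => s _.
  exact: departure_rate_ge0.
Qed.

Lemma has_global_minP Q (j : 'I_M) (k : 'I_(m j)) :
  has_global_min Q j -> k \in Imin Q j -> forall s, (Q (srv k) <= Q s)%N.
Proof.
move=> /existsP[k' /forallP k'_min]; rewrite inE => /forallP k_min s.
exact: leq_trans (k_min k') (k'_min s).
Qed.

Lemma arrival_rate_neq0_min Q s : arrival_rate a Q s != 0 ->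
  forall s', (Q s <= Q s')%N.
Proof.
rewrite /arrival_rate; case: ifP => [/andP[/andP[jmin _] kmin] _ s'|_];
  last by rewrite eqxx.
by have := has_global_minP _ _ _ jmin kmin s'; rewrite /srv; case: s {jmin kmin}.
Qed.

(** Exactly one pool satisfies [is_jdagger], and the rate [a] is shared equally among the servers of
    its nonempty [Imin]. *)
Lemma sum_arrival_rate Q : (0 < M)%N -> (forall j, (0 < m j)%N) ->
  \sum_s arrival_rate a Q s = a.
Proof.
move=> M0 m0.
have [j jP] : exists j, is_jdagger Q j.
  pose s0 : server m := srv (Ordinal (m0 (Ordinal M0))).
  case: (arg_minnP (fun s : server m => Q s) (erefl (xpredT s0))) => s _ s_min.
  have gs : has_global_min Q (tag s).
    apply/existsP; exists (tagged s); apply/forallP => s'.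
    by rewrite /srv; case: s s_min => /= j k; apply.
  case: (arg_minnP (fun j : 'I_M => nat_of_ord j) gs) => j jmin j_min.
  exists j; rewrite /is_jdagger jmin; apply/forallP => j'.
  by apply/implyP => lt_j'j; apply/negP => /j_min; rewrite leqNgt lt_j'j.
have j_unique j' : is_jdagger Q j' -> j' = j.
  move: jP => /andP[gj /forallP mj] /andP[gj' /forallP mj'].
  apply/val_inj; case: (ltngtP j' j) => // [lt_j'j|lt_jj'].
    by have /implyP/(_ lt_j'j) := mj j'; rewrite gj'.
  by have /implyP/(_ lt_jj') := mj' j; rewrite gj.
have Imin0 : #|Imin Q j| != 0%N.
  move: jP => /andP[/existsP[k /forallP k_min] _].
  rewrite -lt0n; apply/card_gt0P; exists k; rewrite inE; apply/forallP => k'.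
  exact: k_min.
rewrite /server -(sig_big_dep predT (fun j k => true)
   (fun j k => arrival_rate a Q (srv k)))/=.
rewrite (bigD1 j)//= [X in _ + X]big1 ?addr0; last first.
  move=> j' j'j; rewrite big1// => k _; rewrite /arrival_rate /=.
  by case: ifP => // /andP[/j_unique e]; rewrite e eqxx in j'j.
under eq_bigr do rewrite /arrival_rate /= jP /=.
rewrite -big_mkcond/= sumr_const -[LHS]mulr_natr divfK//.
by rewrite pnatr_eq0.
Qed.

Hypothesis M_gt0 : (0 < M)%N.
Hypothesis m_gt0 : forall j, (0 < m j)%N.

(** [decr Q s] equals [Q] only at an empty queue, where the departure rate is 0, so excluding the
    diagonal loses nothing. *)
Let sum_moves_off_diag Q (g : state m -> R) :
  \sum_s arrival_rate a Q s * ((incr Q s != Q)%:R * g (incr Q s)) +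
  \sum_s departure_rate mu Q s * ((decr Q s != Q)%:R * g (decr Q s)) =
  \sum_s arrival_rate a Q s * g (incr Q s) +
  \sum_s departure_rate mu Q s * g (decr Q s).
Proof.
congr (_ + _); apply: eq_bigr => s _.
  by have /eqP -> := @incr_neq Q s; rewrite mul1r.
rewrite /departure_rate; case: ifP => [Qs|]; last by rewrite !mul0r.
by have /eqP -> := decr_neq Q s Qs; rewrite mul1r.
Qed.

Lemma exit_rateE Q : exit_rate rate Q = a + total_departure_rate Q.
Proof.
rewrite /exit_rate esum_mkcond.
rewrite (_ : \esum_(s' in _) _ =
    \esum_(Q' in setT) (rate Q Q' * ((Q' != Q)%:R * 1))%:E)%E; last first.
  apply: eq_esum => Q' _; rewrite mulr1.
  case: (eqVneq Q' Q) => [->|ne].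
    by rewrite mulr0 ifF//; apply/negbTE/negP => /set_mem; apply.
  by rewrite mulr1 mem_set//=; apply/eqP.
rewrite (esum_sajsq_rate _ (fun Q' => (Q' != Q)%:R * 1)) => [|Q']; last first.
  by rewrite mulr_ge0.
rewrite (sum_moves_off_diag Q (fun=> 1)) /=.
under eq_bigr do rewrite mulr1.
by under [X in _ + X]eq_bigr do rewrite mulr1; rewrite sum_arrival_rate.
Qed.

Lemma total_departure_rate_ge0 Q : 0 <= total_departure_rate Q.
Proof. by apply: sumr_ge0 => s _; exact: departure_rate_ge0. Qed.

Lemma exit_rate_ge Q : a <= exit_rate rate Q.
Proof. by rewrite exit_rateE lerDl total_departure_rate_ge0. Qed.

(** The mean increment of [h] over one jump is its generator drift divided by the exit rate. *)
Lemma one_step_sajsq (h : state m -> R) (b : R) Q : (forall Q', 0 <= h Q') ->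
  one_step rate h b Q =
  (holding_bound b + (h Q + drift h Q / exit_rate rate Q))%:E.
Proof.
move=> h0; set q := exit_rate rate Q.
have q0 : 0 < q by exact: lt_le_trans (exit_rate_ge Q).
rewrite /one_step [RHS]EFinD; congr adde.
rewrite (_ : \esum_(s' in _) _ =
    \esum_(Q' in setT) (rate Q Q' * ((Q' != Q)%:R * (h Q' / q)))%:E)%E; last first.
  apply: eq_esum => Q' _; rewrite /jump_prob -/q.
  by case: eqVneq => _; congr EFin; rewrite ?mul0r ?mulr0// mul1r mulrAC mulrA.
rewrite (esum_sajsq_rate _ (fun Q' => (Q' != Q)%:R * (h Q' / q))) => [|Q']; last first.
  by rewrite mulr_ge0// divr_ge0// ltW.
rewrite (sum_moves_off_diag Q (fun Q' => h Q' / q)); congr EFin.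
apply: (mulIf (lt0r_neq0 q0)); rewrite [RHS]mulrDl divfK ?gt_eqF//.
have qE : q = \sum_s arrival_rate a Q s + \sum_s departure_rate mu Q s.
  by rewrite /q exit_rateE sum_arrival_rate.
transitivity (\sum_s arrival_rate a Q s * h (incr Q s) +
              \sum_s departure_rate mu Q s * h (decr Q s)).
  rewrite mulrDl !mulr_suml; congr (_ + _); apply: eq_bigr => s _;
  by rewrite -!mulrA mulVf ?gt_eqF// mulr1.
rewrite [in RHS]qE /drift mulrDr !mulr_sumr addrACA.
by congr (_ + _); rewrite -big_split/=; apply: eq_bigr => s _; ring.
Qed.

(** * Drift of the quadratic part *)

Lemma sum_incr (F : server m -> nat -> nat) Q s :
  (\sum_s' F s' (incr Q s s') + F s (Q s) =
   \sum_s' F s' (Q s') + F s (Q s).+1)%N.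
Proof.
rewrite (bigD1 s)//= [in RHS](bigD1 s)//= ffunE eqxx addn1.
rewrite (eq_bigr (fun s' => F s' (Q s'))) => [|s' /negbTE ne]; last first.
  by rewrite ffunE ne addn0.
by rewrite addnC addnA addnAC.
Qed.

Definition queue_sum Q : R := (\sum_s Q s)%:R.
Definition queue_sq_sum Q : R := (\sum_s Q s ^ 2)%:R.

Lemma queue_sq_sum_incr Q s :
  queue_sq_sum (incr Q s) - queue_sq_sum Q = 2 * (Q s)%:R + 1.
Proof.
have /(congr1 (fun n => n%:R : R)) := sum_incr (fun _ n => (n ^ 2)%N) Q s.
rewrite !natrD !natrX -natr1 /queue_sq_sum => e.
apply/eqP; rewrite subr_eq -(inj_eq (addIr ((Q s)%:R ^+ 2))) e; apply/eqP; ring.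
Qed.

Lemma queue_sq_sum_decr Q s : (0 < Q s)%N ->
  queue_sq_sum (decr Q s) - queue_sq_sum Q = 1 - 2 * (Q s)%:R.
Proof.
move=> Qs; have := queue_sq_sum_incr (decr Q s) s; rewrite decrK//.
rewrite ffunE eqxx/= natrB// => e; rewrite -opprB e; ring.
Qed.

Definition total_service : R := \sum_(s : server m) mu (tag s).

Lemma total_service_ge0 : 0 <= total_service.
Proof. by apply: sumr_ge0 => s _; rewrite ltW. Qed.

Lemma total_departure_rate_le Q : total_departure_rate Q <= total_service.
Proof.
by apply: ler_sum => s _; rewrite /departure_rate; case: ifP => // _; rewrite ltW.
Qed.

(** Arrivals join a globally shortest queue, so the mean queue length met by an arrival is at most
    the average of the queue lengths weighted by service rates; both denominators are cleared. *)
Lemma sum_arrival_queue_le Q :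
  (\sum_s arrival_rate a Q s * (Q s)%:R) * total_service <=
  a * \sum_(s : server m) mu (tag s) * (Q s)%:R.
Proof.
rewrite -[X in X * \sum_(s : server m) mu (tag s) * _](sum_arrival_rate Q M_gt0 m_gt0).
rewrite !mulr_suml; apply: ler_sum => s _; rewrite /total_service !mulr_sumr.
apply: ler_sum => s' _; rewrite -mulrA; have [->|ne] := eqVneq (arrival_rate a Q s) 0.
  by rewrite !mul0r.
apply: ler_wpM2l; first exact: arrival_rate_ge0.
rewrite mulrC; apply: ler_wpM2l; first exact: ltW.
by rewrite ler_nat; exact: arrival_rate_neq0_min ne _.
Qed.

(** With [W] the service-weighted queue length, arrivals contribute at most [a + 2 * lambda * W] and
    departures at most [total_service - 2 * W]; finally [W] is at least [delta * queue_sum Q]. *)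
Lemma drift_queue_sq_sum_le (lambda delta : R) Q :
  0 < lambda -> lambda < 1 -> a = lambda * total_service ->
  (forall j, delta <= mu j) ->
  drift queue_sq_sum Q <=
    a + total_service - 2 * (1 - lambda) * delta * queue_sum Q.
Proof.
move=> lambda0 lambda1 aE delta_le.
set W := \sum_(s : server m) mu (tag s) * (Q s)%:R.
have Wge : delta * queue_sum Q <= W.
  rewrite /queue_sum natr_sum mulr_sumr; apply: ler_sum => s _.
  exact: ler_wpM2r.
have C0 : 0 < total_service.
  by move: a_gt0; rewrite aE pmulr_rgt0.
have arr : \sum_s arrival_rate a Q s * (Q s)%:R <= lambda * W.
  rewrite -(ler_pM2r C0); apply: le_trans (sum_arrival_queue_le Q) _.
  by rewrite aE -/W mulrAC.
have -> : drift queue_sq_sum Q =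
    a + 2 * (\sum_s arrival_rate a Q s * (Q s)%:R) +
    \sum_s departure_rate mu Q s * (1 - 2 * (Q s)%:R).
  rewrite /drift; congr (_ + _).
    under eq_bigr do rewrite queue_sq_sum_incr mulrDr mulr1 mulrCA.
    by rewrite big_split/= -mulr_sumr sum_arrival_rate// addrC.
  apply: eq_bigr => s _; rewrite /departure_rate; case: ifP => [Qs|];
    last by rewrite !mul0r.
  by rewrite queue_sq_sum_decr.
have dep : \sum_s departure_rate mu Q s * (1 - 2 * (Q s)%:R) <=
    total_service - 2 * W.
  rewrite /W mulr_sumr -sumrB; apply: ler_sum => s _; rewrite /departure_rate.
  case: ifP => [_|]; first by rewrite mulrBr mulr1 lerD2l lerN2 mulrCA.
  by case: (Q s) => // _; rewrite mul0r !mulr0 subr0 ltW.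
have : (1 - lambda) * (delta * queue_sum Q) <= (1 - lambda) * W.
  by apply: ler_wpM2l => //; rewrite subr_ge0 ltW.
move: arr dep; set A := \sum_s arrival_rate _ _ _ * _; set D := \sum_s _ * _; lra.
Qed.

(** * Drift of the bounded part, which rewards steps towards [z] *)

Section Hitting.
Context (z : state m) (L : nat).
Hypothesis z_le : forall s, (z s <= L)%N.

Let above Q := [forall s, (z s <= Q s)%N].

(* Arrivals raise the smallest queue, so that every state is led to [z] by
   arrivals until it dominates [z], and departures afterwards; this number
   decreases along the way. *)
Definition steps_to Q : nat :=
  if above Q then (\sum_s (Q s - z s))%N
  else (\sum_s (2 * (L - Q s) + Q s))%N.

(** Some queue is below its value in [z], so the shortest one is below [L]. An arrival there lowers
    [2 * (L - Q s)] by 2 and raises [Q s] by 1. If the new state dominates [z], its other formula is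
    smaller still. *)
Let steps_to_arrival Q s : ~~ above Q -> arrival_rate a Q s != 0 ->
  (steps_to (incr Q s) < steps_to Q)%N.
Proof.
move=> Qz Qs; rewrite [X in (_ < X)%N]/steps_to (negbTE Qz).
have /forallPn[s0] := Qz; rewrite -ltnNge => Qs0.
have QsL : (Q s < L)%N.
  apply: leq_ltn_trans (arrival_rate_neq0_min _ _ Qs s0) _.
  exact: leq_trans Qs0 (z_le s0).
have lt_sum : (\sum_s' (2 * (L - incr Q s s') + incr Q s s') <
    \sum_s' (2 * (L - Q s') + Q s'))%N.
  have := sum_incr (fun _ n => 2 * (L - n) + n)%N Q s.
  by set A := (\sum_s' _)%N; set B := (\sum_s' _)%N; lia.
apply: leq_ltn_trans lt_sum; rewrite /steps_to; case: ifP => // _.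
by apply: leq_sum => s' _; lia.
Qed.

Let steps_to_departure Q s : above Q -> (z s < Q s)%N ->
  (steps_to (decr Q s) < steps_to Q)%N.
Proof.
move=> Qz zQs.
have dz : above (decr Q s).
  apply/forallP => s'; have /forallP/(_ s') := Qz.
  by rewrite ffunE; case: eqP => [->|_]; lia.
rewrite /steps_to dz Qz.
have := sum_incr (fun s' n => n - z s')%N (decr Q s) s.
rewrite decrK; last exact: leq_ltn_trans zQs.
rewrite !ffunE eqxx /=.
by set A := (\sum_s' _)%N; set B := (\sum_s' _)%N; lia.
Qed.

Lemma steps_to_le Q : (steps_to Q <= 2 * L * #|{: server m}| + \sum_s Q s)%N.
Proof.
rewrite mulnC -sum_nat_const -big_split /steps_to; case: ifP => _;
  apply: leq_sum => s _ /=.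
  by rewrite (leq_trans (leq_subr _ _)) ?leq_addl.
by rewrite leq_add2r leq_mul2l leq_subr.
Qed.

(* From [Q <> z] transitions of total rate at least [delta] decrease
   [steps_to], and [rho] is small enough for their gain to outweigh all others. *)
Lemma drift_hitting_le (delta rho : R) Q : 0 < delta -> delta <= a ->
  (forall j, delta <= mu j) -> Q <> z ->
  rho = delta / (a + total_service + 1) ->
  drift (fun Q' => 1 - rho ^+ steps_to Q') Q <= - rho ^+ steps_to Q.
Proof.
move=> delta0 delta_a delta_mu Qz rhoE.
have C0 := total_service_ge0.
have q0 : 0 < a + total_service + 1 by rewrite ltr_wpDl// addr_ge0// ltW.
have rho0 : 0 < rho by rewrite rhoE divr_gt0.
have rho1 : rho <= 1.
  by rewrite rhoE ler_pdivrMr// mul1r; move: delta_a C0; lra.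
pose W := rho ^+ steps_to Q; have W0 : 0 < W by rewrite exprn_gt0.
pose V Q' := 1 - rho ^+ steps_to Q'.
have V_diff Q' : V Q' - V Q = W - rho ^+ steps_to Q'.
  by rewrite /V -/W opprB addrC subrKA.
have V_le Q' : V Q' - V Q <= W.
  by rewrite V_diff gerBl exprn_ge0// ltW.
have V_dec Q' : (steps_to Q' < steps_to Q)%N -> V Q' - V Q <= W - W / rho.
  move=> lt_steps.
  rewrite V_diff lerD2l lerN2 /W; case: (steps_to Q) lt_steps => // n.
  rewrite ltnS => le_n; rewrite exprSr mulfK ?gt_eqF//.
  by apply: ler_wiXn2l => //; exact: ltW.
(* A step towards [z] gains [W / rho] up to a loss of [W]. At rate [delta] the gain covers the
   largest possible loss, [(a + total_service) * W], and the [+ 1] in [rho] leaves the surplus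
   [W]. *)
have Wrho : delta * (W / rho) = (a + total_service + 1) * W.
  by rewrite rhoE; field; rewrite !gt_eqF.
have W_rho0 : 0 <= W / rho by rewrite divr_ge0// ltW.
have depW : total_departure_rate Q * W <= total_service * W.
  by apply: ler_wpM2r; [exact: ltW|exact: total_departure_rate_le].
have arrW : \sum_s arrival_rate a Q s * W = a * W.
  by rewrite -mulr_suml sum_arrival_rate.
rewrite -/W /drift -/(V Q); have [above_Q|not_above] := boolP (above Q).
(* Above [z], one departure from a queue in excess supplies the gain. *)
- have [s0 zs0] : exists s0, (z s0 < Q s0)%N.
    apply/existsP; apply: contrapT => /negP/existsPn h; apply: Qz.
    apply/ffunP => s; apply/eqP; rewrite eqn_leq leqNgt h /=.
    by have /forallP := above_Q; apply.
  have arr : \sum_s arrival_rate a Q s * (V (incr Q s) - V Q) <= a * W.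
    rewrite -arrW; apply: ler_sum => s _; apply: ler_wpM2l => //.
    exact: arrival_rate_ge0.
  have dep : \sum_s departure_rate mu Q s * (V (decr Q s) - V Q) <=
      total_service * W - delta * (W / rho).
    apply: le_trans (_ : total_departure_rate Q * W - delta * (W / rho) <= _);
      last by rewrite lerD2r.
    rewrite /total_departure_rate mulr_suml (bigD1 s0)//= [in leRHS](bigD1 s0)//=.
    rewrite [leRHS]addrAC; apply: lerD; last first.
      by apply: ler_sum => s _; apply: ler_wpM2l; [exact: departure_rate_ge0|].
    rewrite /departure_rate (leq_ltn_trans _ zs0)//.
    have := V_dec _ (steps_to_departure _ _ above_Q zs0).
    move=> /(ler_wpM2l (ltW (mu_gt0 (tag s0)))).
    have := ler_wpM2r W_rho0 (delta_mu (tag s0)); rewrite mulrBr.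
    by set x := _ * (_ - _); lra.
  by move: arr dep; rewrite Wrho; lra.
(* Otherwise every arrival supplies it, at total rate [a]. *)
- have arr : \sum_s arrival_rate a Q s * (V (incr Q s) - V Q) <= a * W - a * (W / rho).
    rewrite -mulrBr -[in leRHS](sum_arrival_rate Q M_gt0 m_gt0) mulr_suml.
    apply: ler_sum => s _; have [->|ne] := eqVneq (arrival_rate a Q s) 0.
      by rewrite !mul0r.
    apply: ler_wpM2l; first exact: arrival_rate_ge0.
    exact/V_dec/steps_to_arrival.
  have dep : \sum_s departure_rate mu Q s * (V (decr Q s) - V Q) <=
      total_service * W.
    apply: le_trans depW; rewrite /total_departure_rate mulr_suml.
    by apply: ler_sum => s _; apply: ler_wpM2l; [exact: departure_rate_ge0|].
  have := ler_wpM2r W_rho0 delta_a; rewrite Wrho.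
  by move: arr dep; lra.
Qed.

End Hitting.

(** * Combination of the two parts and application of the criterion *)

Lemma drift_combination (g h : state m -> R) (k : R) Q :
  drift (fun Q' => g Q' + k * h Q') Q = drift g Q + k * drift h Q.
Proof.
rewrite /drift mulrDr addrACA !mulr_sumr.
by congr (_ + _); rewrite -big_split/=; apply: eq_bigr => s _; ring.
Qed.

(** A departure undoes an arrival, so if arrivals always change [f], departures of positive rate do
    too. *)
Lemma sajsq_rate_same {T : Type} (f : state m -> T) Q Q' :
  (forall Q s, f (incr Q s) <> f Q) -> f Q = f Q' -> rate Q Q' = 0.
Proof.
move=> f_incr fQ; rewrite /sajsq_rate big1 => [|s /eqP e]; last first.
  by case: (f_incr Q s); rewrite -e.
rewrite add0r big1// => s /eqP e; rewrite /departure_rate.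
case: ifP => // Qs; case: (f_incr (decr Q s) s).
by rewrite decrK// fQ e.
Qed.

Lemma rate_lower_bound :
  exists2 delta, 0 < delta & delta <= a /\ forall j, delta <= mu j.
Proof.
have [j _ j_min] := arg_minP mu (erefl (xpredT (Ordinal M_gt0))).
exists (Order.min a (mu j)); first by rewrite lt_min a_gt0 mu_gt0.
split=> [|k]; first by rewrite ge_min lexx.
by rewrite ge_min j_min ?orbT.
Qed.

Lemma foster_lyapunov (lambda c : R) (z : state m) :
  0 < lambda -> lambda < 1 -> a = lambda * total_service -> 0 <= c ->
  exists2 k : R, 0 <= k & exists2 g : state m -> R,
    (forall Q, 0 <= g Q <= 1) &
    forall Q, Q <> z -> drift (fun Q' => queue_sq_sum Q' + k * g Q') Q <= - c.
Proof.
move=> lambda0 lambda1 aE c0.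
have [delta delta0 [delta_a delta_mu]] := rate_lower_bound.
have C0 := total_service_ge0.
pose rho := delta / (a + total_service + 1).
have q0 : 0 < a + total_service + 1 by rewrite ltr_wpDl// addr_ge0// ltW.
have rho0 : 0 < rho by rewrite divr_gt0.
have rho1 : rho <= 1.
  by rewrite ler_pdivrMr// mul1r; move: delta_a C0; lra.
pose L := (\sum_s z s)%N.
have z_le s : (z s <= L)%N by rewrite /L (bigD1 s)//= leq_addr.
pose g Q := 1 - rho ^+ steps_to z L Q.
pose eps := 2 * (1 - lambda) * delta.
have eps0 : 0 < eps by rewrite !mulr_gt0// subr_gt0.
(* The excess to absorb is [b]. Beyond [n] jobs the linear term of the quadratic drift does it; with
   at most [n] jobs [steps_to] is at most [D], and the weight [b / rho ^+ D] turns the bounded drift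
   into at most [- b]. *)
pose b := a + total_service + c.
have b0 : 0 <= b by rewrite !addr_ge0// ltW.
pose n := (Num.truncn (b / eps)).+1.
pose D := (2 * L * #|{: server m}| + n)%N.
have k0 : 0 <= b / rho ^+ D by rewrite divr_ge0// exprn_ge0// ltW.
exists (b / rho ^+ D) => //; exists g => [Q|Q Qz].
  rewrite /g subr_ge0 exprn_ile1 ?(ltW rho0)//= lerBlDr lerDl.
  by rewrite exprn_ge0// ltW.
rewrite drift_combination.
have Vdrift := drift_queue_sq_sum_le _ _ Q lambda0 lambda1 aE delta_mu.
have gdrift := drift_hitting_le _ _ z_le _ rho Q delta0 delta_a delta_mu Qz erefl.
have [small|large] := leqP (\sum_s Q s) n.
- have gdrift_b : b / rho ^+ D * drift g Q <= - b.
    have -> : - b = b / rho ^+ D * - rho ^+ D.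
      by rewrite mulrN divfK// lt0r_neq0// exprn_gt0.
    apply: ler_wpM2l => //; apply: le_trans gdrift _; rewrite lerN2.
    apply: ler_wiXn2l => //; first exact: ltW.
    by apply: leq_trans (steps_to_le _ _ _) _; rewrite leq_add2l.
  apply: le_trans (lerD Vdrift gdrift_b) _.
  have : 0 <= eps * queue_sum Q by rewrite mulr_ge0// ltW.
  by rewrite -/eps /b; clear; lra.
- have b_le : b <= eps * queue_sum Q.
    rewrite mulrC -ler_pdivrMr//.
    have /andP[_ /ltW] := truncn_itv (divr_ge0 b0 (ltW eps0)).
    move=> /le_trans; apply; rewrite ler_nat; exact: ltnW.
  have gdrift_0 : b / rho ^+ D * drift g Q <= 0.
    apply: mulr_ge0_le0 => //; apply: le_trans gdrift _.
    by rewrite oppr_le0 exprn_ge0// ltW.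
  apply: le_trans (lerD Vdrift gdrift_0) _.
  by move: b_le; rewrite -/eps /b; clear; lra.
Qed.

Lemma sajsq_positive_recurrent (lambda : R) {T : Type} (f : state m -> T) :
  0 < lambda -> lambda < 1 -> a = lambda * total_service ->
  (forall Q s, f (incr Q s) <> f Q) ->
  (forall z, exists L, forall Q, f Q = f z -> forall s, (Q s <= L)%N) ->
  positive_recurrent rate f.
Proof.
move=> lambda0 lambda1 aE f_incr f_bound d Om P X z [Y [H [YH XYH]]] start.
(* An almost sure event is nonempty, so [z] is the image under [f] of an actual state [z0]. *)
have [w Xw] : exists w, omap f (X 0 w) = Some z.
  have PT : (0 < P setT)%E by rewrite probability_setT.
  have := ae_properfilter_algebraOfSetsType PT.
  move=> ae_proper; exact: (@filter_ex _ _ ae_proper _ start).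
case: (X 0 w) Xw => [z0|//] /= [fz]; rewrite -fz in start *.
have [L f_le] := f_bound z0.
have C0 := total_service_ge0.
have hb0 : 0 <= holding_bound a.
  by rewrite addr_ge0// invr_ge0 subr_ge0 -expR0 ler_expR oppr_le0 ltW.
(* Exit rates are at most [a + total_service], so a drift below minus this product stays below
   [- holding_bound a] after division by the exit rate. *)
have c0 : 0 <= holding_bound a * (a + total_service).
  by rewrite mulr_ge0// addr_ge0// ltW.
have [k k0 [g g01 drift_le]] := foster_lyapunov _ _ z0 lambda0 lambda1 aE c0.
pose h Q := queue_sq_sum Q + k * g Q.
have h0 Q : 0 <= h Q by rewrite addr_ge0// mulr_ge0//; case/andP: (g01 Q).
have q0 Q : 0 < exit_rate rate Q by exact: lt_le_trans (exit_rate_ge Q).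
have one_step_le Q : Q <> z0 -> (one_step rate h a Q <= (h Q)%:E)%E.
  move=> Qz; rewrite one_step_sajsq// lee_fin.
  have : drift h Q / exit_rate rate Q <= - holding_bound a.
    rewrite ler_pdivrMr//; apply: le_trans (drift_le _ Qz) _.
    rewrite mulNr lerN2; apply: ler_wpM2l => //.
    by rewrite exit_rateE lerD2l total_departure_rate_le.
  lra.
(* The drift inequality says nothing at [z0]; [one_step] is finite there and enters the uniform
   bound separately. Elsewhere in the level set [h] is bounded because the queues are. *)
pose x := fine (one_step rate h a z0).
apply: (integral_return_time_lty rate P Y H YH h z0 a sajsq_rate_ge0 a_gt0
  exit_rate_ge h0 _ f X XYH (`|x| + ((#|{: server m}| * L ^ 2)%:R + k))) => //.
- by move=> Q /eqP; exact: one_step_le.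
- move=> Q Q' fQ fQ'; rewrite /jump_prob; case: ifP => // _.
  by rewrite (sajsq_rate_same f) ?mul0r// fQ.
- move=> Q fQ; have [->|/eqP Qz] := eqVneq Q z0.
    rewrite /x one_step_sajsq//= lee_fin; apply: le_trans (ler_norm _) _.
    by rewrite lerDl addr_ge0.
  apply: le_trans (one_step_le _ Qz) _; rewrite lee_fin.
  apply: le_trans (_ : (#|{: server m}| * L ^ 2)%:R + k <= _); last by rewrite lerDr.
  apply: lerD.
    rewrite ler_nat -sum_nat_const; apply: leq_sum => s _.
    by rewrite leq_sqr; exact: f_le.
  by rewrite ler_piMr//; case/andP: (g01 Q).
Qed.

End Dynamics.

(** * Tail measures and the conclusion for both processes *)

Lemma sum_serverE {R : realType} {M : nat} (m : 'I_M -> nat) (F : 'I_M -> R) :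
  \sum_(s : server m) F (tag s) = \sum_j (m j)%:R * F j.
Proof.
rewrite -(sig_big_dep predT (fun j (k : 'I_(m j)) => true) (fun j k => F j))/=.
by apply: eq_bigr => j _; rewrite sumr_const card_ord mulr_natl.
Qed.

(** At level [(Q s).+1] in the pool of [s], the arrival adds exactly one server to the count. *)
Lemma tail_measure_incr_neq {R : realType} {M : nat} (m : 'I_M -> nat)
    (Q : state m) (s : server m) :
  tail_measure (incr Q s) <> tail_measure Q :> (nat -> 'I_M -> R).
Proof.
case: s => j k; set s : server m := Tagged _ k.
move=> /(congr1 (fun x : nat -> 'I_M -> R => x (Q s).+1 j)).
rewrite /tail_measure; apply/eqP.
rewrite (inj_eq (mulfI _)); last first.
  by rewrite invr_eq0 pnatr_eq0 -lt0n; exact: leq_trans (ltn_ord k).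
rewrite -!natr_sum eqr_nat (bigD1 k)//= [X in _ != X](bigD1 k)//=.
rewrite ffunE eqxx addn1 leqnn ltnn add0n.
rewrite (eq_bigr (fun k' : 'I_(m j) => ((Q s).+1 <= Q (srv k'))%N : nat)) => [|k' ne].
  by rewrite neq_ltn ltnSn orbT.
rewrite ffunE (_ : (srv k' == s) = (k' == k)); last exact: eq_Tagged.
by rewrite (negbTE ne) addn0.
Qed.

(** The tails of [z] vanish above its total number of jobs, so equal tails leave no longer queue in
    [Q]. *)
Lemma tail_measure_bounded {R : realType} {M : nat} (m : 'I_M -> nat)
    (z : state m) : exists L, forall Q : state m,
  tail_measure Q = tail_measure z :> (nat -> 'I_M -> R) ->
  forall s, (Q s <= L)%N.
Proof.
pose L := (\sum_s z s)%N.
have z_le s : (z s <= L)%N by rewrite /L (bigD1 s)//= leq_addr.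
exists L => Q Qz [j k]; rewrite leqNgt; apply/negP => L_lt.
have := congr1 (fun x : nat -> 'I_M -> R => x L.+1 j) Qz.
rewrite /tail_measure [X in _ = _ * X]big1 => [|k' _]; last first.
  by rewrite ltnNge z_le.
rewrite mulr0; apply/eqP; rewrite mulf_neq0//.
  by rewrite invr_eq0 pnatr_eq0 -lt0n; exact: leq_trans (ltn_ord k).
by rewrite -natr_sum pnatr_eq0 (bigD1 k)//= L_lt.
Qed.

Theorem theorem7 (R : realType) (M : nat) (mu gamma : 'I_M -> R)
    (lambda : R) (N : nat) (m : 'I_M -> nat)
    (M_gt0 : (0 < M)%N)
    (mu_decr : forall j k : 'I_M, (j < k)%N -> mu k < mu j)
    (mu_gt0 : forall j, 0 < mu j)
    (gamma_gt0 : forall j, 0 < gamma j)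
    (gamma_le1 : forall j, gamma j <= 1)
    (gamma_sum : \sum_j gamma j = 1)
    (gamma_mu_sum : \sum_j gamma j * mu j = 1)
    (lambda_gt0 : 0 < lambda)
    (lambda_lt1 : lambda < 1)
    (N_gt0 : (0 < N)%N)
    (m_gt0 : forall j, (0 < m j)%N)
    (mE : forall j, (m j)%:R = N%:R * gamma j) :
  positive_recurrent (@sajsq_rate R M m (N%:R * lambda) mu) (@id (state m)) /\
  positive_recurrent (@sajsq_rate R M m (N%:R * lambda) mu)
    (@tail_measure R M m).
Proof.
have a_gt0 : 0 < N%:R * lambda by rewrite mulr_gt0// ltr0n.
(* By the normalization [gamma_mu_sum] the total service rate is [N], so [lambda] is the load. *)
have aE : N%:R * lambda = lambda * total_service m mu.
  rewrite mulrC /total_service sum_serverE; congr (_ * _).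
  under eq_bigr do rewrite mE -mulrA.
  by rewrite -mulr_sumr gamma_mu_sum mulr1.
have pr := sajsq_positive_recurrent m (N%:R * lambda) mu a_gt0 mu_gt0 M_gt0 m_gt0
  lambda.
split; apply: pr => //.
- exact: incr_neq.
- move=> z; exists (\sum_s z s)%N => Q -> s.
  by rewrite (bigD1 s)//= leq_addr.
- exact: tail_measure_incr_neq.
- exact: tail_measure_bounded.
Qed.
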